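(* Let $|\phi\rangle$ be a Majorana dimer state vector on $N_S\ge 1$ spins and $|\psi\rangle$ a Majorana dimer state vector on $N_T\ge 1$ spins. Then the contraction $|\omega\rangle$ of $|\phi\rangle$ and $|\psi\rangle$ (last index of $|\phi\rangle$ with first index of $|\psi\rangle$), a vector on $N_S+N_T-2$ spins, is either zero or, up to a nonzero scalar, again a Majorana dimer state vector.
   Context: Majorana operators. On $L$ spins, with Hilbert space $(\mathbb{C}^2)^{\otimes L}$ and Pauli operators $X_k,Y_k,Z_k$ on site $k$, put $\gamma_{2k-1}=Z_1\cdots Z_{k-1}X_k$ and $\gamma_{2k}=Z_1\cdots Z_{k-1}Y_k$ for $k=1,\dots,L$. These satisfy $\gamma_j\gamma_k+\gamma_k\gamma_j=2\delta_{j,k}$. Majorana dimer state. A nonzero (normalized) vector $|\psi\rangle\in(\mathbb{C}^2)^{\otimes L}$ is a Majorana dimer state vector if there are a partition $\Omega$ of $\{1,\dots,2L\}$ into $L$ pairs $(j,k)$ with $j<k$ (the dimers) and signs $p_{j,k}\in\{+1,-1\}$ (the dimer parities) such that $(\gamma_j+\mathrm{i}\,p_{j,k}\gamma_k)|\psi\rangle=0$ for all $(j,k)\in\Omega$. The pairing and the parities determine the vector up to a scalar. For $L=0$, any nonzero scalar counts as a Majorana dimer state vector. Contraction. Write $|\phi\rangle=\sum_{k\in\{0,1\}^{N_S}}S_{k_1,\dots,k_{N_S}}|k_1,\dots,k_{N_S}\rangle$ and $|\psi\rangle=\sum_{k\in\{0,1\}^{N_T}}T_{k_1,\dots,k_{N_T}}|k_1,\dots,k_{N_T}\rangle$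 in the computational ($Z$) basis, with $Z|0\rangle=|0\rangle$, $Z|1\rangle=-|1\rangle$. Put $N_U=N_S+N_T-2$. The contraction is $|\omega\rangle=\sum_{k\in\{0,1\}^{N_U}}U_{k_1,\dots,k_{N_U}}|k_1,\dots,k_{N_U}\rangle$ with $U_{k_1,\dots,k_{N_U}}=\sum_{a\in\{0,1\}}S_{k_1,\dots,k_{N_S-1},a}\,T_{a,k_{N_S},\dots,k_{N_U}}$. The dimer conditions for $|\omega\rangle$ refer to the Majorana operators on the remaining $N_U$ spins in this order. *)

(* Defs.v *)
From HB Require Import structures.
From mathcomp Require Import all_boot all_order all_algebra.
From mathcomp Require Import complex reals.
Set Implicit Arguments.
Unset Strict Implicit.
Unset Printing Implicit Defensive.
Import Order.TTheory GRing.Theory Num.Theory.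
Local Open Scope ring_scope.

Section Spins.
Variable C : numClosedFieldType.

(* A basis vector |k_1,...,k_L> is a function 'I_L -> 'I_2, sites being
   numbered from 0, and a vector is the family of its amplitudes.  The codomain
   is C^o rather than C so that vectors inherit a C-module structure. *)
Definition bits (L : nat) := {ffun 'I_L -> 'I_2}.
Definition state (L : nat) := {ffun bits L -> C^o}.

Definition mx2 (a b c d : C) : 'M[C]_2 :=
  \matrix_(i, j) if i == 0 then (if j == 0 then a else b)
                 else (if j == 0 then c else d).
Definition pauliX := mx2 0 1 1 0.
Definition pauliY := mx2 0 (- 'i) 'i 0.
Definition pauliZ := mx2 1 0 0 (-1).

Definition set_bit L (b : bits L) (k : 'I_L) (a : 'I_2) : bits L :=
  [ffun l => if l == k then a else b l].

(* 1 (x) ... (x) M (x) ... (x) 1, with M acting on site k. *)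
Definition on_site L (M : 'M[C]_2) (k : 'I_L) (v : state L) : state L :=
  [ffun b : bits L => \sum_(a < 2) M (b k) a * v (set_bit b k a)].

Lemma majorana_site_subproof L (j : 'I_(2 * L)) : (j./2 < L)%N.
Proof. by rewrite ltn_half_double -mul2n. Qed.

Definition majorana_site L (j : 'I_(2 * L)) : 'I_L :=
  Ordinal (majorana_site_subproof j).

(* Indices start at 0: the usual gamma_(2k-1) and gamma_(2k), 1 <= k <= L, are
   [majorana] at 2(k-1) and 2(k-1)+1, both living on site k-1. *)
Definition majorana L (j : 'I_(2 * L)) : state L -> state L :=
  let k := majorana_site j in
  (\big[comp/id]_(l < L | (l < k)%N) on_site pauliZ l)
    \o on_site (if odd j then pauliY else pauliX) k.

(* The number of pairs is not recorded: it is forced to be L. *)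
Definition pairing L (Om : {set 'I_(2 * L) * 'I_(2 * L)}) : Prop :=
  (forall j k, (j, k) \in Om -> (j < k)%N) /\
  partition [set [set jk.1; jk.2] | jk in Om] [set: 'I_(2 * L)].

(* Vectors are only required to be nonzero, not of norm 1.  For L = 0 the
   second conjunct is vacuously true, so every nonzero scalar qualifies. *)
Definition majorana_dimer_state L (v : state L) : Prop :=
  v != 0 /\
  exists (Om : {set 'I_(2 * L) * 'I_(2 * L)}) (p : 'I_(2 * L) -> 'I_(2 * L) -> C),
    [/\ pairing Om,
        forall j k, (j, k) \in Om -> p j k = 1 \/ p j k = -1
      & forall j k, (j, k) \in Om ->
          majorana j v + ('i * p j k) *: majorana k v = 0].

(* (k_1, ..., k_m, a) and (a, k_(m+1), ..., k_(m+n)). *)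
Definition left_bits m n (k : bits (m + n)) (a : 'I_2) : bits m.+1 :=
  [ffun i => if unlift ord_max i is Some j then k (lshift n j) else a].
Definition right_bits m n (k : bits (m + n)) (a : 'I_2) : bits n.+1 :=
  [ffun i => if unlift ord0 i is Some j then k (rshift m j) else a].

Definition contraction m n (S : state m.+1) (T : state n.+1) : state (m + n) :=
  [ffun k : bits (m + n) =>
     \sum_(a < 2) S (left_bits k a) * T (right_bits k a)].

End Spins.

(* Main.v *)
(* The product of all Majorana operators is, up to a phase, the total parity
   Z_1...Z_N; reordered along the dimers it acts as a scalar, so a dimer state
   phi satisfies P phi = e phi with e = 1 or -1.  Hence the operators acting on
   either tensor can be moved through the contraction: the vectors
     u_x = <gamma_x phi, psi>  (x a mode of phi),
     u_y = e <phi, gamma_y psi>  (y a mode of psi)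
   are exactly gamma_z <phi, psi> for the modes that survive, while for the
   contracted spins u of the last X (resp. Y) Majorana of phi is i times u of
   the first Y (resp. X) Majorana of psi.  A dimer (x, y) says u_x = +-i u_y,
   a relation stable under composition of three steps; joining dimers through
   the two contracted edges therefore again gives dimers. *)
Require Import Defs.
From mathcomp Require Import all_boot all_order all_algebra.
From mathcomp Require Import complex reals.
From mathcomp Require Import ring.
Set Implicit Arguments.
Unset Strict Implicit.
Unset Printing Implicit Defensive.
Import Order.TTheory GRing.Theory Num.Theory.
Local Open Scope ring_scope.

(** * Perfect matchings as fixed-point-free involutions *)

Section Matching.

(** A perfect matching of [S] with partners related by [R], given by its partner map; the values of
    [f] outside [S] are arbitrary. *)
Definition matching (V : eqType) (S : pred V) (R : V -> V -> Prop) : Prop :=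
  exists f : V -> V,
    forall x, S x -> [/\ S (f x), f (f x) = x, f x != x & R x (f x)].

(** The extra edge from [c] to [d] makes a path [f c], [c], [d], [f d], whose ends become partners
    by the three-step rule. If [c] and [d] are already partners, the pair just disappears. *)
Lemma matching_glue (V : eqType) (S : pred V) (R : V -> V -> Prop) (c d : V) :
    (forall x y, R x y -> R y x) ->
    (forall x y z t, R x y -> R y z -> R z t -> R x t) ->
  S c -> S d -> c != d -> R c d -> matching S R ->
  matching (fun x => [&& S x, x != c & x != d]) R.
Proof.
move=> Rsym R3 Sc Sd ncd Rcd [f fP].
have fI x y : S x -> S y -> f x = f y -> x = y.
  by move=> /fP[_ fx _ _] /fP[_ fy _ _] e; rewrite -fx e fy.
exists (fun x => if f x == c then f d else if f x == d then f c else f x).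
move=> x /and3P[Sx xc xd].
have [Sfx ffx nfx Rx] := fP _ Sx.
have [Sfc ffc nfc Rc] := fP _ Sc.
have [Sfd ffd nfd Rd] := fP _ Sd.
have [fxc|nxc] := eqVneq (f x) c.
  have xE : x = f c by rewrite -fxc ffx.
  rewrite ffd (eq_sym d) (negbTE ncd) eqxx Sfd nfd andbT /= -xE; split=> //.
  - by apply: contraNneq xd => e; apply/eqP/fI; rewrite // fxc -ffd e.
  - by apply: contraNneq ncd => e; apply/eqP/fI; rewrite // e -xE.
  - by apply: R3 Rd; [rewrite fxc in Rx; exact: Rx|].
have [fxd|nxd] := eqVneq (f x) d.
  have xE : x = f d by rewrite -fxd ffx.
  rewrite ffc eqxx Sfc nfc /= -xE; split=> //.
  - by apply: contraNneq xc => e; apply/eqP/fI; rewrite // fxd -ffc e.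
  - by apply: contraNneq ncd => e; apply/eqP/fI; rewrite // e -xE.
  - by apply: R3 Rc; [rewrite fxd in Rx; exact: Rx|apply: Rsym].
by rewrite Sfx ffx nxc nxd (negbTE xc) (negbTE xd).
Qed.

(** Relabels a matching along a bijection [emb] from [W] onto [S]; finiteness of [W] lets the
    preimage of a partner be found by search. *)
Lemma matching_transfer (V : eqType) (W : finType) (S : pred V)
    (R : V -> V -> Prop) (R' : W -> W -> Prop) (emb : W -> V) :
    injective emb -> (forall w, S (emb w)) ->
    (forall v, S v -> exists w, emb w = v) ->
    (forall x y, R (emb x) (emb y) -> R' x y) ->
  matching S R -> matching predT R'.
Proof.
move=> embI Semb embS RR' [f fP].
(* The default [w] is never reached, since [f (emb w)] lies in [S] and so in the image of [emb]. *)
pose g w := odflt w [pick w' | emb w' == f (emb w)].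
have gE w : emb (g w) = f (emb w).
  rewrite /g; case: pickP => [w' /eqP //|no].
  have [/embS[w' e] _ _ _] := fP _ (Semb w).
  by have := no w'; rewrite e eqxx.
exists g => w _; have [_ ff nf Rf] := fP _ (Semb w); split=> //.
- by apply: embI; rewrite !gE.
- by apply: contraNneq nf => e; rewrite -gE e.
- by apply: RR'; rewrite gE.
Qed.

Lemma perm_flatten_pairs (V : eqType) (f : V -> V) (s : seq V) :
  perm_eq (flatten [seq [:: x; f x] | x <- s]) (s ++ map f s).
Proof.
elim: s => //= x s IH; rewrite perm_cons.
by rewrite perm_sym perm_catC /= perm_cons perm_catC perm_sym.
Qed.

Lemma perm_matching_pairs (V : finType) (f : V -> V) :
    (forall x, f (f x) = x) -> (forall x, f x != x) ->
  exists s, perm_eq (flatten [seq [:: x; f x] | x <- s]) (index_enum V).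
Proof.
(* The element of smaller rank represents its pair; [f] exchanges the representatives with the
   rest. *)
move=> fK fN; pose a x := (enum_rank x < enum_rank (f x))%N.
exists (filter a (index_enum V)).
rewrite (perm_trans (perm_flatten_pairs _ _)) //.
rewrite perm_sym -(perm_filterC a) perm_sym perm_cat2l.
apply: uniq_perm; rewrite ?filter_uniq ?index_enum_uniq //.
  by rewrite (map_inj_uniq (can_inj fK)) filter_uniq ?index_enum_uniq.
move=> x; rewrite -{1}(fK x) (mem_map (can_inj fK)) !mem_filter !mem_index_enum /= andbT.
rewrite /a fK andbT -leqNgt ltn_neqAle; case: eqP => //= /val_inj/enum_rank_inj e.
by have := fN x; rewrite e eqxx.
Qed.

End Matching.

(** * Vectors that differ by a factor i or -i *)

Section Fermions.
Variable C : numClosedFieldType.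

(** A dimer condition with its parity forgotten. *)
Definition linked (E : lmodType C) (x y : E) : Prop :=
  x = 'i *: y \/ x = - 'i *: y.

Lemma linked_sym (E : lmodType C) (x y : E) : linked x y -> linked y x.
Proof.
by case=> ->; [right|left]; rewrite scalerA ?mulrN ?mulNr -expr2 sqrCi opprK scale1r.
Qed.

(** A product of three factors i or -i is again one of them, whereas a product of two is 1 or -1;
    hence three steps and not two. *)
Lemma linked_trans3 (E : lmodType C) (x y z t : E) :
  linked x y -> linked y z -> linked z t -> linked x t.
Proof.
have i3 (v : E) : 'i *: ('i *: ('i *: v)) = - ('i *: v).
  by rewrite !scalerA -expr2 sqrCi mulN1r scaleNr.
by case=> ->; case=> ->; case=> ->; rewrite ?(scaleNr, scalerN, opprK) i3;
  rewrite /linked scaleNr ?opprK; auto.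
Qed.

Lemma linked_scalable (E F : lmodType C) (h : E -> F) (x y : E) :
  scalable h -> linked x y -> linked (h x) (h y).
Proof. by move=> hZ [->|->]; rewrite hZ /linked; auto. Qed.

(** * Majorana operators as bit flips with coefficients *)

Definition sgb (a : 'I_2) : C := (-1) ^+ a.

Lemma sgb_sq a : sgb a * sgb a = 1.
Proof. by rewrite -expr2 sqrr_sign. Qed.

Lemma sgb_rev a : sgb (rev_ord a) = - sgb a.
Proof. by case: a => [[|[|//]] ?]; rewrite /sgb /= ?expr0 ?expr1 ?opprK. Qed.

Definition flip L (k : 'I_L) (b : bits L) : bits L := set_bit b k (rev_ord (b k)).

Lemma flipE L (k l : 'I_L) (b : bits L) :
  flip k b l = if l == k then rev_ord (b k) else b l.
Proof. by rewrite ffunE. Qed.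

Lemma flipK L (k : 'I_L) : involutive (flip k).
Proof.
move=> b; apply/ffunP => l; rewrite !flipE eqxx; case: eqP => // ->.
by rewrite rev_ordK.
Qed.

Lemma flipC L (k l : 'I_L) (b : bits L) : flip k (flip l b) = flip l (flip k b).
Proof.
apply/ffunP => j; rewrite !flipE; have [->|nkl] := eqVneq k l; first by [].
by have [->|] := eqVneq j k; rewrite ?(negbTE nkl).
Qed.

(* A mode [(k, o)] is the Majorana operator on site [k] built from X ([o = false])
   or Y ([o = true]). *)
Definition coef L (x : 'I_L * bool) (b : bits L) : C :=
  (\prod_(l < L | (l < x.1)%N) sgb (b l)) * (if x.2 then - 'i * sgb (b x.1) else 1).

Definition gam L (x : 'I_L * bool) (v : state C L) : state C L :=
  [ffun b => coef x b * v (flip x.1 b)].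

Lemma gamZ L (x : 'I_L * bool) : scalable (gam x).
Proof. by move=> a v; apply/ffunP => b; rewrite !ffunE /= mulrCA. Qed.

(** The sign depends only on whether [k] lies in the Z string of [x], or is the site of [x] with a Y
    on it, and not on [b]. This independence is what makes Majorana operators commute up to a
    sign. *)
Lemma coef_flip L (x : 'I_L * bool) (k : 'I_L) :
  exists2 e : C, e * e = 1 & forall b, coef x (flip k b) = e * coef x b.
Proof.
have [d dd dE] : exists2 d : C, d * d = 1 & forall b : bits L,
    \prod_(l < L | (l < x.1)%N) sgb (flip k b l)
    = d * \prod_(l < L | (l < x.1)%N) sgb (b l).
  have [lt|ge] := boolP (k < x.1)%N.
    exists (-1); first by rewrite mulrNN mulr1.
    move=> b; rewrite (bigD1 k) //= [in RHS](bigD1 k) //= flipE eqxx sgb_rev.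
    rewrite !mulNr mul1r; congr (- (_ * _)).
    by apply: eq_bigr => l /andP[_ /negbTE nl]; rewrite flipE nl.
  exists 1; first by rewrite mulr1.
  move=> b; rewrite mul1r; apply: eq_bigr => l lx; rewrite flipE.
  by case: eqP lx ge => // -> ->.
have [/andP[/eqP xk x2]|n] := boolP ((x.1 == k) && x.2).
  exists (- d); first by rewrite mulrNN.
  by move=> b; rewrite /coef dE x2 xk flipE eqxx sgb_rev; ring.
exists d => // b; rewrite /coef dE -mulrA; do 2 congr (_ * _).
by case: x.2 n => //; rewrite andbT flipE => /negbTE ->.
Qed.

Lemma gam_comm L (x y : 'I_L * bool) :
  exists2 e : C, e * e = 1 & forall v, gam x (gam y v) = e *: gam y (gam x v).
Proof.
have [d dd dE] := coef_flip x y.1; have [e ee eE] := coef_flip y x.1.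
exists (d * e); first by rewrite mulrACA dd ee mulr1.
move=> v; apply/ffunP => b; rewrite !ffunE /= dE eE flipC.
rewrite /GRing.scale /=; ring: dd ee.
Qed.

(** The Z strings square to 1, leaving XY = iZ or YX = -iZ on site [k]. *)
Lemma gam_pair L (k : 'I_L) (o : bool) (v : state C L) b :
  gam (k, o) (gam (k, ~~ o) v) b = (if o then - 'i else 'i) * sgb (b k) * v b.
Proof.
rewrite !ffunE flipK /coef /=.
set p := \prod_(l < L | _) _; set q := \prod_(l < L | _) sgb (flip k b l).
have -> : q = p.
  by apply: eq_bigr => l lk; rewrite flipE; case: eqP lk => // ->; rewrite ltnn.
have pp : p * p = 1 by rewrite /p -big_split big1 //= => l _; rewrite sgb_sq.
by case: o; rewrite flipE eqxx sgb_rev /=; ring: pp.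
Qed.

Lemma gam_sq L (x : 'I_L * bool) (v : state C L) : gam x (gam x v) = v.
Proof.
apply/ffunP => b; rewrite !ffunE flipK /coef.
set p := \prod_(l < L | _) _; set q := \prod_(l < L | _) sgb (flip _ b l).
have -> : q = p.
  by apply: eq_bigr => l lk; rewrite flipE; case: eqP lk => // ->; rewrite ltnn.
have pp : p * p = 1 by rewrite /p -big_split big1 //= => l _; rewrite sgb_sq.
have ii : 'i * 'i = -1 :> C by rewrite -expr2 sqrCi.
have ss := sgb_sq (b x.1).
by case: x.2; rewrite ?flipE ?eqxx ?sgb_rev; ring: pp ii ss.
Qed.

(** * Products of Majorana operators and the total parity *)

Definition gams L (s : seq ('I_L * bool)) (v : state C L) : state C L :=
  foldr (@gam L) v s.

Lemma gams_cat L (s t : seq ('I_L * bool)) v : gams (s ++ t) v = gams s (gams t v).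
Proof. exact: foldr_cat. Qed.

Lemma gams_swap L (s : seq ('I_L * bool)) x :
  exists2 e : C, e * e = 1 & forall v, gams s (gam x v) = e *: gam x (gams s v).
Proof.
elim: s => [|y s [e ee eE]]; first by exists 1 => [|v]; rewrite ?mulr1 ?scale1r.
have [d dd dE] := gam_comm y x; exists (d * e); first by rewrite mulrACA dd ee mulr1.
by move=> v; rewrite /= eE gamZ dE scalerA mulrC.
Qed.

Lemma gams_perm L (s t : seq ('I_L * bool)) : perm_eq s t ->
  exists2 e : C, e * e = 1 & forall v, gams s v = e *: gams t v.
Proof.
elim: s t => [|x s IH] t; first by rewrite perm_sym => /perm_nilP->;
  exists 1 => [|v]; rewrite ?mulr1 ?scale1r.
move=> st; have xt : x \in t by rewrite -(perm_mem st) mem_head.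
case/splitPr: xt st => t1 t2.
rewrite perm_sym perm_catC /= perm_cons perm_catC perm_sym => /IH[e ee eE].
have [d dd dE] := gams_swap t1 x; exists (e * d); first by rewrite mulrACA dd ee mulr1.
by move=> v; rewrite /= eE gamZ !gams_cat /= dE scalerA -mulrA dd mulr1.
Qed.

Definition parity_op L (v : state C L) : state C L :=
  [ffun b : bits L => (\prod_l sgb (b l)) * v b].

Lemma gams_sites L (r : seq 'I_L) (v : state C L) b :
  gams (flatten [seq [:: x; (x.1, ~~ x.2)] | x <- [seq (k, false) | k <- r]]) v b
  = 'i ^+ size r * (\prod_(k <- r) sgb (b k)) * v b.
Proof.
elim: r b => [|k r IH] b; first by rewrite big_nil expr0 !mul1r.
by rewrite /= (gam_pair k false) IH big_cons exprS; ring.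
Qed.

(** The product of all Majorana operators is evaluated on [v] in two orders, which agree up to a
    sign: site by site it is a power of i times the parity, dimer by dimer it is a scalar. *)
Lemma parity_eigen L (v : state C L) :
    matching predT (fun x y => linked (gam x v) (gam y v)) -> v != 0 ->
  exists2 e : C, e * e = 1 & parity_op v = e *: v.
Proof.
move=> [f fP] v0.
have [s sP] := perm_matching_pairs (fun x => let: And4 _ h _ _ := fP x isT in h)
  (fun x => let: And4 _ _ h _ := fP x isT in h).
(* The other matching of the modes: X with Y on the same site. *)
pose g (x : 'I_L * bool) := (x.1, ~~ x.2).
pose t := [seq (k, false) | k <- enum 'I_L].
have tP : perm_eq (flatten [seq [:: x; g x] | x <- t]) (index_enum ('I_L * bool)%type).
  rewrite (perm_trans (perm_flatten_pairs _ _)) //.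
  apply: uniq_perm; rewrite ?index_enum_uniq //.
    have inj (o : bool) : injective (fun k : 'I_L => (k, o)) by move=> ? ? [].
    rewrite cat_uniq -map_comp (map_inj_uniq (inj false)) (map_inj_uniq (inj true)).
    by rewrite enum_uniq andbT; apply/hasPn => _ /mapP[k _ ->]; apply/mapP => -[].
  move=> [k o]; rewrite mem_index_enum mem_cat -map_comp.
  by apply/orP; case: o; [right|left]; apply/mapP; exists k; rewrite ?mem_enum.
(* On [v] the operator of [f x] acts as i or -i times that of [x], which squares to 1, so each dimer
   contributes a scalar. *)
have [c cE] : exists c, gams (flatten [seq [:: x; f x] | x <- s]) v = c *: v.
  elim: s {sP} => [|x s [c cE]]; first by exists 1; rewrite scale1r.
  have [_ _ _ /linked_sym lx] := fP x isT.
  rewrite /= cE !gamZ.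
  by case: lx => ->; rewrite gamZ gam_sq scalerA; [exists (c * 'i)|exists (c * - 'i)].
have /gams_perm[d dd dE] := perm_trans tP (etrans (perm_sym _ _) sP).
have PE : gams (flatten [seq [:: x; g x] | x <- t]) v = 'i ^+ L *: parity_op v.
  apply/ffunP => b; rewrite gams_sites !ffunE size_enum_ord big_enum.
  by rewrite -mulrA.
have iL : 'i ^+ L != 0 :> C by rewrite expf_neq0 // neq0Ci.
have : parity_op v = ('i ^- L * (d * c)) *: v.
  by rewrite -!scalerA -cE -dE PE scalerA mulVf // scale1r.
set e := _ * _ => eE; exists e => //.
(* At a nonzero amplitude the eigenvalue equals a product of signs, so its square is 1. *)
have [b vb] : exists b, v b != 0.
  apply/existsP; apply: contraNT v0 => /existsPn h.
  by apply/eqP/ffunP => b; have /negPn/eqP := h b; rewrite ffunE.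
have := congr1 (fun w : state C L => w b) eE; rewrite /parity_op !ffunE.
move=> /(mulIf vb) <-.
by rewrite -big_split big1 //= => l _; rewrite sgb_sq.
Qed.

(** * Agreement with the Majorana operators built from Pauli matrices *)

Lemma on_site_pauliZ L (k : 'I_L) (v : state C L) b :
  on_site (pauliZ C) k v b = sgb (b k) * v b.
Proof.
have bk : set_bit b k (b k) = b.
  by apply/ffunP => l; rewrite ffunE; case: eqP => // ->.
rewrite ffunE !big_ord_recl big_ord0 addr0 !mxE.
move: bk; case: (b k) => [[|[|//]] lt] bk /=; rewrite /sgb /=.
  rewrite mul0r addr0 (_ : ord0 = Ordinal lt) ?bk //; exact: val_inj.
rewrite mul0r add0r (_ : lift _ _ = Ordinal lt) ?bk //; exact: val_inj.
Qed.

Lemma on_site_pauliXY L (k : 'I_L) (o : bool) (v : state C L) b :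
  on_site (if o then pauliY C else pauliX C) k v b
  = (if o then - 'i * sgb (b k) else 1) * v (flip k b).
Proof.
rewrite ffunE !big_ord_recl big_ord0 addr0 /flip.
case: (b k) => [[|[|//]] lt]; rewrite /sgb.
  rewrite (_ : rev_ord _ = lift ord0 ord0); last exact: val_inj.
  by case: o; rewrite !mxE /= ?expr0 ?mulr1 mul0r add0r.
rewrite (_ : rev_ord _ = ord0); last exact: val_inj.
by case: o; rewrite !mxE /= ?expr1 ?mulrNN ?mulr1 mul0r addr0.
Qed.

Lemma majorana_gam L (j : 'I_(2 * L)) (v : state C L) :
  majorana j v = gam (majorana_site j, odd j) v.
Proof.
apply/ffunP => b; rewrite [RHS]ffunE /majorana /coef /=.
set w := on_site _ _ _; rewrite -mulrA -on_site_pauliXY -/w.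
(* Each Z of the string is diagonal, so it is peeled off as a factor [sgb (b l)]. *)
elim: index_enum w b => [|l r IH] w b; first by rewrite !big_nil mul1r.
by rewrite !big_cons; case: ifP => // _; rewrite /= on_site_pauliZ IH mulrA.
Qed.

(** * Dimer states as matchings of modes *)

Lemma mode_subproof L (x : 'I_L * bool) : (x.2 + x.1.*2 < 2 * L)%N.
Proof. by rewrite mul2n -ltn_half_double half_bit_double. Qed.

Definition mode L (x : 'I_L * bool) : 'I_(2 * L) := Ordinal (mode_subproof x).

Lemma modeK L : cancel (@mode L) (fun j => (majorana_site j, odd j)).
Proof.
move=> [k o]; congr (_, _); last by rewrite /= oddD odd_double addbF; case: o.
by apply: val_inj; rewrite /= half_bit_double.
Qed.

Lemma unmodeK L : cancel (fun j => (majorana_site j, odd j)) (@mode L).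
Proof. by move=> j; apply: val_inj; rewrite /= odd_double_half. Qed.

(** Nonvanishing is left out, so that the property passes to a contraction even when it is zero. *)
Definition dimerized L (v : state C L) : Prop :=
  matching predT (fun x y => linked (gam x v) (gam y v)).

(** Covering gives every index a partner, disjointness of the blocks makes it unique; symmetry of
    [R] removes the orientation of the pairs. *)
Lemma pairing_matching L (Om : {set 'I_(2 * L) * 'I_(2 * L)})
    (R : 'I_(2 * L) -> 'I_(2 * L) -> Prop) :
    pairing Om -> (forall x y, R x y -> R y x) ->
    (forall j k, (j, k) \in Om -> R j k) -> matching predT R.
Proof.
move=> [Olt /and3P[/eqP cov triv _]] Rsym OR.
pose adj j k := ((j, k) \in Om) || ((k, j) \in Om).
have adjC j k : adj j k = adj k j by rewrite /adj orbC.
have adjN j k : adj j k -> j != k.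
  by case/orP => /Olt; [rewrite ltn_neqAle|rewrite ltn_neqAle eq_sym] => /andP[].
have adjB j k : adj j k -> [set j; k] \in [set [set jk.1; jk.2] | jk in Om].
  by case/orP => h; apply/imsetP; [exists (j, k)|exists (k, j); rewrite // setUC].
have adj1 j k k' : adj j k -> adj j k' -> k = k'.
  move=> jk jk'; have e : [set j; k] = [set j; k'].
    apply: contraTeq isT => /(trivIsetP triv _ _ (adjB _ _ jk) (adjB _ _ jk')).
    by move/pred0P/(_ j); rewrite /= !inE !eqxx.
  have : k \in [set j; k'] by rewrite -e !inE eqxx orbT.
  by rewrite !inE eq_sym (negbTE (adjN _ _ jk)) => /eqP.
have adjE j : exists k, adj j k.
  have : j \in cover [set [set jk.1; jk.2] | jk in Om] by rewrite cov inE.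
  case/bigcupP => _ /imsetP[[x y] xy ->]; rewrite !inE /= => /orP[]/eqP->.
    by exists y; rewrite /adj xy.
  by exists x; rewrite /adj xy orbT.
pose f j := odflt j [pick k | adj j k].
have fP j : adj j (f j).
  by rewrite /f; case: pickP => //= no; have [k] := adjE j; rewrite no.
exists f => j _; split=> //.
- by apply: (adj1 (f j)); rewrite ?fP // adjC.
- by rewrite eq_sym adjN.
- by case/orP: (fP j) => /OR // /Rsym.
Qed.

(** The blocks are the orbits [[set z; f z]], each listed once with its smaller element first. *)
Lemma matching_pairing L (R : 'I_(2 * L) -> 'I_(2 * L) -> Prop) :
    matching predT R ->
  exists2 Om : {set 'I_(2 * L) * 'I_(2 * L)}, pairing Om &
    forall j k, (j, k) \in Om -> R j k.
Proof.
move=> [f fP].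
pose Om := [set jk : 'I_(2 * L) * 'I_(2 * L) |
  (jk.1 < jk.2)%N && (f jk.1 == jk.2)].
have ff j : f (f j) = j by case: (fP j isT).
have block A z : A \in [set [set jk.1; jk.2] | jk in Om] -> z \in A -> A = [set z; f z].
  case/imsetP => -[x y]; rewrite inE /= => /andP[_ /eqP <-] ->.
  by rewrite !inE => /orP[]/eqP-> //; rewrite ff setUC.
exists Om; last first.
  by move=> j k; rewrite inE /= => /andP[_ /eqP <-]; case: (fP j isT).
split; first by move=> j k; rewrite inE => /andP[].
apply/and3P; split.
- rewrite eqEsubset subsetT; apply/subsetP => z _; apply/bigcupP.
  exists [set z; f z]; last by rewrite !inE eqxx.
  have [_ _ nf _] := fP z isT; apply/imsetP.
  have [lt|gt|/val_inj e] := ltngtP z (f z).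
  + by exists (z, f z); rewrite // inE /= lt eqxx.
  + by exists (f z, z); [rewrite inE /= gt ff eqxx|exact: setUC].
  + by rewrite -e eqxx in nf.
- apply/trivIsetP => A B AP BP; apply: contraR.
  case/pred0Pn => z /andP[/= zA zB].
  by rewrite (block _ _ AP zA) (block _ _ BP zB).
- apply/imsetP => -[[x y] _ /setP/(_ x)]; by rewrite !inE eqxx.
Qed.

Lemma dimer_state_dimerized L (v : state C L) :
  majorana_dimer_state v <-> v != 0 /\ dimerized v.
Proof.
split=> -[v0 h]; split=> //.
  case: h => Om [p [OP p1 pv]].
  apply: (@matching_transfer _ _ predT
    (fun j k => linked (majorana j v) (majorana k v)) _ (@mode L)) => //.
  - exact: can_inj (@modeK L).
  - by move=> j _; exists (majorana_site j, odd j); rewrite unmodeK.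
  - by move=> x y; rewrite !majorana_gam !modeK.
  apply: pairing_matching OP _ _ => [x y|j k jk]; first exact: linked_sym.
  have /eqP := pv j k jk; rewrite addr_eq0 -scaleNr => /eqP ->.
  by case: (p1 j k jk) => ->; rewrite ?mulrN ?opprK mulr1 /linked; auto.
have : matching predT (fun j k => linked (majorana j v) (majorana k v)).
  apply: (matching_transfer (emb := fun j => (majorana_site j, odd j))) h => //.
  - exact: can_inj (@unmodeK L).
  - by move=> x _; exists (mode x); rewrite modeK.
  - by move=> x y; rewrite !majorana_gam.
case/matching_pairing => Om OP lOm.
(* The parity is read off from the vector: the dimer condition says that the factor i or -i equals
   -i p. *)
exists Om, (fun j k => if majorana j v == 'i *: majorana k v then -1 else 1).
split=> // [j k _|j k /lOm]; first by case: ifP; auto.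
case: eqP => [-> _|ne [//|->]]; first by rewrite mulrN1 scaleNr subrr.
by rewrite mulr1 scaleNr addNr.
Qed.

(** * Moving Majorana operators through the contraction *)

Section Contraction.
Variables m n : nat.
Implicit Types (S : state C m.+1) (T : state C n.+1) (k : bits (m + n)).

Lemma left_bits_lift k a i : left_bits k a (lift ord_max i) = k (lshift n i).
Proof. by rewrite ffunE liftK. Qed.

Lemma left_bits_max k a : left_bits k a ord_max = a.
Proof. by rewrite ffunE unlift_none. Qed.

Lemma right_bits_lift k a j : right_bits k a (lift ord0 j) = k (rshift m j).
Proof. by rewrite ffunE liftK. Qed.

Lemma right_bits0 k a : right_bits k a ord0 = a.
Proof. by rewrite ffunE unlift_none. Qed.

Lemma left_bits_flip_lift k a i :
  flip (lift ord_max i) (left_bits k a) = left_bits (flip (lshift n i) k) a.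
Proof.
apply/ffunP => l; rewrite flipE; case: (unliftP ord_max l) => [j ->|->].
  by rewrite !left_bits_lift flipE (inj_eq lift_inj) (inj_eq (@lshift_inj _ _)).
by rewrite !left_bits_max (negbTE (neq_lift _ _)).
Qed.

Lemma left_bits_flip_max k a : flip ord_max (left_bits k a) = left_bits k (rev_ord a).
Proof.
apply/ffunP => l; rewrite flipE; case: (unliftP ord_max l) => [j ->|->].
  by rewrite !left_bits_lift eq_sym (negbTE (neq_lift _ _)).
by rewrite !left_bits_max eqxx.
Qed.

Lemma left_bits_flip_right k a j : left_bits (flip (rshift m j) k) a = left_bits k a.
Proof.
apply/ffunP => l; case: (unliftP ord_max l) => [i ->|->]; last by rewrite !left_bits_max.
by rewrite !left_bits_lift flipE eq_lrshift.
Qed.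

Lemma right_bits_flip_lift k a j :
  flip (lift ord0 j) (right_bits k a) = right_bits (flip (rshift m j) k) a.
Proof.
apply/ffunP => l; rewrite flipE; case: (unliftP ord0 l) => [i ->|->].
  by rewrite !right_bits_lift flipE (inj_eq lift_inj) (inj_eq (@rshift_inj _ _)).
by rewrite !right_bits0 (negbTE (neq_lift _ _)).
Qed.

Lemma right_bits_flip0 k a : flip ord0 (right_bits k a) = right_bits k (rev_ord a).
Proof.
apply/ffunP => l; rewrite flipE; case: (unliftP ord0 l) => [j ->|->].
  by rewrite !right_bits_lift eq_sym (negbTE (neq_lift _ _)).
by rewrite !right_bits0 eqxx.
Qed.

Lemma right_bits_flip_left k a i : right_bits (flip (lshift n i) k) a = right_bits k a.
Proof.
apply/ffunP => l; case: (unliftP ord0 l) => [j ->|->]; last by rewrite !right_bits0.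
by rewrite !right_bits_lift flipE eq_rlshift.
Qed.

Lemma split_lshift (i : 'I_m) : split (lshift n i) = inl i.
Proof. exact: (unsplitK (inl i)). Qed.

Lemma split_rshift (j : 'I_n) : split (rshift m j) = inr j.
Proof. exact: (unsplitK (inr j)). Qed.

Lemma contractionZl a S T : contraction (a *: S) T = a *: contraction S T.
Proof.
apply/ffunP => k; rewrite !ffunE scaler_sumr; apply: eq_bigr => b _.
by rewrite ffunE scalerAl.
Qed.

Lemma contractionZr a S T : contraction S (a *: T) = a *: contraction S T.
Proof.
apply/ffunP => k; rewrite !ffunE scaler_sumr; apply: eq_bigr => b _.
by rewrite ffunE scalerAr.
Qed.

(** The Z string of a surviving site of the left tensor stops before the contracted site. *)
Lemma coef_left k a (i : 'I_m) o :
  coef (lift ord_max i, o) (left_bits k a) = coef (lshift n i, o) k.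
Proof.
rewrite /coef /= left_bits_lift; congr (_ * _).
have bumpE (l : 'I_m) : bump m l = l by exact: lift_max.
rewrite bumpE big_mkcond (bigD1_ord ord_max) // ltnNge ltnW //= mul1r.
rewrite [RHS]big_mkcond big_split_ord /=.
rewrite [X in _ * X]big1 ?mulr1 => [|j _]; last by rewrite ltnNge ltnW // ltn_addr.
by apply: eq_bigr => l _; rewrite left_bits_lift bumpE.
Qed.

Lemma gam_contraction_left (i : 'I_m) o S T :
  gam (lshift n i, o) (contraction S T) = contraction (gam (lift ord_max i, o) S) T.
Proof.
apply/ffunP => k; rewrite !ffunE mulr_sumr; apply: eq_bigr => a _.
by rewrite ffunE left_bits_flip_lift right_bits_flip_left coef_left mulrA.
Qed.

(** After contraction the string also runs over the surviving left sites. The left parity supplies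
    these signs, and its extra [sgb a] cancels the one from the contracted site in the right
    string. *)
Lemma coef_right k a (j : 'I_n) o :
  (\prod_l sgb (left_bits k a l)) * coef (lift ord0 j, o) (right_bits k a)
  = coef (rshift m j, o) k.
Proof.
rewrite /coef /= right_bits_lift mulrA; congr (_ * _).
rewrite big_mkcond (bigD1_ord ord_max) //= left_bits_max.
rewrite [X in _ * X]big_mkcond (bigD1_ord ord0) //= right_bits0.
rewrite mulrACA [sgb a * _ * _]mulrC [RHS]big_mkcond big_split_ord /=.
rewrite sgb_sq mulr1; congr (_ * _); apply: eq_bigr => l _.
  by rewrite left_bits_lift ltn_addr.
by rewrite right_bits_lift ltn_add2l.
Qed.

(** The missing part of the Z string is inserted as the parity of [S], at the price of its
    eigenvalue [e]. *)
Lemma gam_contraction_right e (j : 'I_n) o S T : parity_op S = e *: S ->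
  gam (rshift m j, o) (contraction S T)
  = e *: contraction S (gam (lift ord0 j, o) T).
Proof.
move=> SP; rewrite -contractionZl -SP.
apply/ffunP => k; rewrite !ffunE mulr_sumr; apply: eq_bigr => a _.
rewrite !ffunE right_bits_flip_lift left_bits_flip_right -(coef_right _ a).
by rewrite -/(left_bits k a) -/(right_bits k a); ring.
Qed.

(** The parity of [S] cancels the Z string of the last mode up to a Z on the contracted bit, and
    this Z exchanges X and Y up to a phase. *)
Lemma gam_contraction_glue e o S T : parity_op S = e *: S ->
  contraction (gam (ord_max, o) S) T
  = 'i *: (e *: contraction S (gam (ord0, ~~ o) T)).
Proof.
move=> SP; rewrite -contractionZl -SP -contractionZl.
(* One side flips the contracted bit in [S], the other in [T]; complementing the summation bit
   aligns them. *)
apply/ffunP => k; rewrite !ffunE [RHS](reindex_inj rev_ord_inj); apply: eq_bigr => a _.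
rewrite !ffunE left_bits_flip_max right_bits_flip0 rev_ordK.
pose p := \prod_(i < m) sgb (k (lshift n i)).
have -> : \prod_l sgb (left_bits k (rev_ord a) l) = - sgb a * p.
  rewrite (bigD1_ord ord_max) //= left_bits_max sgb_rev; congr (_ * _).
  by apply: eq_bigr => i _; rewrite left_bits_lift.
rewrite /coef /= left_bits_max right_bits0 [X in _ = _ * (X * _ * _)]big_pred0 //.
have -> : \prod_(l < m.+1 | (l < m)%N) sgb (left_bits k a l) = p.
  rewrite big_mkcond (bigD1_ord ord_max) //= ltnn mul1r; apply: eq_bigr => i _.
  by rewrite left_bits_lift (lift_max i : bump m i = i) ltn_ord.
have ii : 'i * 'i = -1 :> C by rewrite -expr2 sqrCi.
have ss := sgb_sq a.
by rewrite /GRing.scale /= sgb_rev; case: o => /=; ring: ii ss.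
Qed.

End Contraction.

(** * Joining the dimers of the two tensors *)

Lemma contraction_dimerized m n (S : state C m.+1) (T : state C n.+1) :
  dimerized S -> S != 0 -> dimerized T -> dimerized (contraction S T).
Proof.
move=> dS S0 dT; have [e ee SP] := parity_eigen dS S0.
pose u (x : 'I_m.+1 * bool + 'I_n.+1 * bool) :=
  match x with
  | inl x => contraction (gam x S) T
  | inr x => e *: contraction S (gam x T)
  end.
pose emb (x : 'I_(m + n) * bool) : 'I_m.+1 * bool + 'I_n.+1 * bool :=
  match split x.1 with
  | inl i => inl (lift ord_max i, x.2)
  | inr j => inr (lift ord0 j, x.2)
  end.
have uE x : u (emb x) = gam x (contraction S T).
  case: x => k o; rewrite /emb /= -{2}(splitK k); case: (split k) => i /=.
    by rewrite gam_contraction_left.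
  by rewrite (gam_contraction_right _ _ _ SP).
(* Before gluing, the dimers of [S] and of [T] together match all modes of both tensors, as [u] is
   homogeneous on each side. *)
have mu : matching predT (fun x y => linked (u x) (u y)).
  case: dS dT => [f fP] [g gP].
  exists (fun x => match x with inl x => inl (f x) | inr x => inr (g x) end).
  case=> x _.
    have [_ fx nx lx] := fP x isT; split=> //=; first by rewrite fx.
    apply: (@linked_scalable _ _ (fun v => contraction v T)) lx => a v.
    by rewrite contractionZl.
  have [_ fx nx lx] := gP x isT; split=> //=; first by rewrite fx.
  apply: (@linked_scalable _ _ (fun v => e *: contraction S v)) lx => a v.
  by rewrite contractionZr !scalerA mulrC.
have glue o : linked (u (inl (ord_max, o))) (u (inr (ord0, ~~ o))).
  by left; exact: gam_contraction_glue.
have lsym x y : linked (u x) (u y) -> linked (u y) (u x) by exact: linked_sym.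
have l3 x y z t : linked (u x) (u y) -> linked (u y) (u z) -> linked (u z) (u t) ->
  linked (u x) (u t) by exact: linked_trans3.
(* The two contracted edges have no common end, so the second is still available after the first is
   removed. *)
have := matching_glue lsym l3 _ _ _ (glue false) mu; move=> /(_ isT isT isT) mu1.
have mu2 := matching_glue lsym l3 _ _ _ (glue true) mu1.
(* The four contracted modes are gone, and what remains is exactly the image of [emb]. *)
apply: (matching_transfer (emb := emb)) (mu2 _ _ isT);
  try by apply/and3P; split=> //; apply/eqP => -[].
- move=> [k o] [k' o']; rewrite /emb /= -{2}(splitK k) -{2}(splitK k').
  case: (split k) (split k') => i [] j //= [].
    by move=> /(can_inj (bumpK _))/val_inj -> ->.
  by rewrite !add0n => /val_inj -> ->.
- move=> [k o]; rewrite /emb /=.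
  have neq N (h : 'I_N) i o1 o2 : (lift h i, o1) != (h, o2) :> 'I_N * bool.
    by rewrite xpair_eqE eq_sym (negbTE (neq_lift _ _)).
  by case: (split k) => i; apply/andP; split; apply/andP; split=> //; exact: neq.
- move=> [] [k o].
    case: (unliftP ord_max k) => [i ->|->]; last by case: o; rewrite /= ?eqxx ?andbF.
    by exists (lshift n i, o); rewrite /emb /= split_lshift.
  case: (unliftP ord0 k) => [i ->|->]; last by case: o; rewrite /= ?eqxx ?andbF.
  by exists (rshift m i, o); rewrite /emb /= split_rshift.
- by move=> x y; rewrite !uE.
Qed.

End Fermions.

(** * Dimer states over the complex numbers *)

Local Open Scope complex_scope.

Theorem theorem1 (R : realType) (m n : nat)
    (phi : state R[i] m.+1) (psi : state R[i] n.+1)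
    (hphi : majorana_dimer_state phi) (hpsi : majorana_dimer_state psi) :
  contraction phi psi = 0 \/
  exists c : R[i], c != 0 /\ majorana_dimer_state (c *: contraction phi psi).
Proof.
have [phi0 dphi] := (dimer_state_dimerized phi).1 hphi.
have [_ dpsi] := (dimer_state_dimerized psi).1 hpsi.
have [->|w0] := eqVneq (contraction phi psi) 0; [by left|right].
(* Dimer states are asked to be nonzero rather than of norm 1, so the scalar can be 1. *)
exists 1; split; first exact: oner_neq0.
rewrite scale1r; apply/dimer_state_dimerized; split=> //.
exact: contraction_dimerized.
Qed.
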